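(* For all real $a,b>0$ and every $m\in\mathbb{N}$ (that is, $m\ge 1$), $$\frac{1}{m}\sum_{k=1}^{m}a^{\frac{2k-1}{2m}}b^{\frac{2m-(2k-1)}{2m}}\le\left(\frac{1}{m}\sum_{k=1}^{m}a^{\frac{m-k}{m}}b^{\frac{k-1}{m}}\right)\left\{\frac{a^{\frac1m}\left(a^{\frac1m}+b^{\frac1m}\right)b^{\frac1m}}{2}\right\}^{1/3}\le L(a,b)$$ and $$L(a,b)\le\frac{2}{3m}\sum_{k=1}^{m}a^{\frac{2k-1}{2m}}b^{\frac{2m-(2k-1)}{2m}}+\frac{1}{3m}\left(\sum_{k=0}^{m}a^{\frac{k}{m}}b^{\frac{m-k}{m}}-\frac{a+b}{2}\right)\le\frac{1}{m}\left(\sum_{k=0}^{m}a^{\frac{k}{m}}b^{\frac{m-k}{m}}-\frac{a+b}{2}\right).$$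
   Context: $L(a,b)$ is the logarithmic mean of $a,b>0$: $L(a,b)=\dfrac{a-b}{\log a-\log b}$ for $a\neq b$, and $L(a,a)=a$. *)

(* Defs.v *)
From HB Require Import structures.
From mathcomp Require Import all_boot all_order all_algebra.
From mathcomp Require Import all_classical all_reals all_analysis.

Set Implicit Arguments.
Unset Strict Implicit.
Unset Printing Implicit Defensive.

Import Order.TTheory GRing.Theory Num.Theory.

Local Open Scope ring_scope.

Definition logmean (R : realType) (a b : R) : R :=
  if a == b then a else (a - b) / (ln a - ln b).

(* Main.v *)
Require Import Defs.
From HB Require Import structures.
From mathcomp Require Import all_boot all_order all_algebra.
From mathcomp Require Import all_classical all_reals all_analysis.
From mathcomp Require Import ring lra.

Set Implicit Arguments.
Unset Strict Implicit.
Unset Printing Implicit Defensive.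

Import Order.TTheory GRing.Theory Num.Theory.
Import numFieldNormedType.Exports.

Local Open Scope ring_scope.

(** Put x = a^(1/2m) and y = b^(1/2m). Every sum in the statement is a multiple
    of the single sum S = \sum_(i < m) (x^2)^(m-1-i) (y^2)^i: the sum over odd
    multiples of 1/2m is x y S (a midpoint rule), the sum over multiples of 1/m
    minus (a + b)/2 is (x^2 + y^2)/2 S ([trapezoid_sum]), and, as
    a - b = (x^2 - y^2) S and ln a - ln b = m (ln x^2 - ln y^2), the
    logarithmic mean of a and b is S/m times that of x^2 and y^2 ([logmeanX]).
    After division by S/m >= 0, all four inequalities compare the geometric
    mean G = x y, the arithmetic mean A = (x^2 + y^2)/2 and the logarithmic
    mean L of the two numbers x^2 and y^2:
      G <= (G^2 A)^(1/3) <= L <= (2 G + A)/3 <= A.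
    The outer two are G <= A. For the inner two, let t = ln x - ln y: then
    A = G cosh t and L = G sinh t / t, so they read
      (cosh t)^(1/3) <= sinh t / t <= (2 + cosh t)/3.
    Both sides are even in t, and for t >= 0 each inequality says that a
    function vanishing at 0 is nonnegative, which holds because its derivative
    is visibly nonnegative ([cbrt_cosh_le], [mul3_sinh_le]). *)

(** * Bounds for the hyperbolic sine *)

Section Hyperbolic.
Variable R : realType.
Implicit Types t x y : R.

Definition sinh t : R := (expR t - expR (- t)) / 2.
Definition cosh t : R := (expR t + expR (- t)) / 2.

Lemma sinh0 : sinh 0 = 0.
Proof. by rewrite /sinh oppr0 subrr mul0r. Qed.

Lemma cosh0 : cosh 0 = 1.
Proof. by rewrite /cosh oppr0 expR0; lra. Qed.

Lemma sinhN t : sinh (- t) = - sinh t.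
Proof. by rewrite /sinh opprK; lra. Qed.

Lemma coshN t : cosh (- t) = cosh t.
Proof. by rewrite /cosh opprK addrC. Qed.

Lemma sqr_sinh t : sinh t ^+ 2 = cosh t ^+ 2 - 1.
Proof.
have := expRxMexpNx_1 t; rewrite /sinh /cosh.
move: (expR t) (expR (- t)) => u v uv.
by rewrite -[X in _ = _ - X]uv; field.
Qed.

Lemma cosh_gt0 t : 0 < cosh t.
Proof. by rewrite divr_gt0// addr_gt0// expR_gt0. Qed.

Lemma is_derive_expRN t : is_derive t 1 (fun u => expR (- u)) (- expR (- t)).
Proof.
have De := is_derive_expR (- t).
apply: (is_derive_eq (is_derive1_comp De (is_deriveNid t 1))).
by rewrite mulrN1.
Qed.

Lemma is_derive_sinh t : is_derive t 1 sinh (cosh t).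
Proof.
have D := is_derive_expRN t.
apply: (is_derive_eq (is_deriveM (is_deriveB _ D)
  (is_derive_cst (2^-1 : R) t 1))).
by rewrite /cosh /GRing.scale /=; lra.
Qed.

Lemma is_derive_cosh t : is_derive t 1 cosh (sinh t).
Proof.
have D := is_derive_expRN t.
apply: (is_derive_eq (is_deriveM (is_deriveD _ D)
  (is_derive_cst (2^-1 : R) t 1))).
by rewrite /sinh /GRing.scale /=; lra.
Qed.

Lemma le_of_derive_ge0 (f df : R -> R) t : 0 <= t ->
    (forall x, is_derive x 1 f (df x)) -> (forall x, 0 <= df x) ->
  f 0 <= f t.
Proof.
rewrite le_eqVlt => /predU1P[<-//|t0] Df df0.
have cf : {within `[0, t], continuous f}%classic.
  by apply: derivable_within_continuous => x _; case: (Df x).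
have [c _ fE] := MVT t0 (fun x _ => Df x) cf.
by rewrite -subr_ge0 fE subr0 mulr_ge0// ltW.
Qed.

(** The function t - 3 sinh t / (2 + cosh t) vanishes at 0, and by
    sinh^2 = cosh^2 - 1 its derivative is the square
    ((cosh t - 1) / (2 + cosh t))^2. *)
Lemma mul3_sinh_le t : 0 <= t -> 3 * sinh t <= t * (2 + cosh t).
Proof.
move=> t0.
have q0 x : 0 < 2 + cosh x by rewrite addr_gt0// cosh_gt0.
pose f x := x - 3 * (sinh x * (2 + cosh x)^-1).
pose df x := (cosh x - 1) ^+ 2 / (2 + cosh x) ^+ 2.
have df_ge0 x : 0 <= df x by rewrite divr_ge0// sqr_ge0.
have Df x : is_derive x 1 f (df x).
  have DV := @is_deriveV _ (cst 2 + cosh) _ _ _ (lt0r_neq0 (q0 x))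
    (is_deriveD (is_derive_cst (2 : R) x 1) (is_derive_cosh x)).
  have DM := is_deriveM (is_derive_sinh x) DV.
  apply: (is_derive_eq (is_deriveB (is_derive_id x 1)
    (is_deriveM (is_derive_cst (3 : R) x 1) DM))).
  have := sqr_sinh x; have := q0 x.
  rewrite /df /GRing.scale /= mulr0 (_ : (cst 2 + cosh) x = 2 + cosh x)//.
  move: (cosh x) (sinh x) => c s c0 sE.
  (* Isolates s ^+ 2, the only way in which s enters the derivative. *)
  rewrite (_ : s * _ = - (s ^+ 2 / (2 + c) ^+ 2)); last by field; lra.
  by rewrite sE; field; lra.
have := le_of_derive_ge0 t0 Df df_ge0.
rewrite /f sinh0 mul0r mulr0 subr0 subr_ge0 mulrA.
by rewrite ler_pdivrMr.
Qed.

(** With w = (cosh t)^(-1/3), the function w sinh t - t vanishes at 0; since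
    cosh t = w^-3 and sinh^2 t = w^-6 - 1, its derivative is
    (w^6 - 3 w^2 + 2) / (3 w^2) = (w^2 - 1)^2 (w^2 + 2) / (3 w^2). *)
Lemma cbrt_cosh_le t : 0 <= t -> t * cosh t `^ (1 / 3) <= sinh t.
Proof.
move=> t0.
pose w x := cosh x `^ (- (1 / 3)).
have w0 x : 0 < w x by rewrite powR_gt0// cosh_gt0.
have w3 x : w x ^+ 3 = (cosh x)^-1.
  rewrite -powR_mulrn ?ltW// /w -powRrM -[RHS]powR_inv1 ?ltW ?cosh_gt0//.
  by congr (_ `^ _); field.
pose f x := sinh x * w x - x.
pose df x := (w x ^+ 2 - 1) ^+ 2 * (w x ^+ 2 + 2) / (3 * w x ^+ 2).
have df_ge0 x : 0 <= df x.
  by rewrite divr_ge0// mulr_ge0// ?addr_ge0// sqr_ge0.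
have Df x : is_derive x 1 f (df x).
  have c0 := cosh_gt0 x.
  have Dp := is_derive1_powR (- (1 / 3)) c0.
  have Dw := is_derive1_comp Dp (is_derive_cosh x).
  have DM := is_deriveM (is_derive_sinh x) Dw.
  apply: (is_derive_eq (is_deriveB DM (is_derive_id x 1))).
  rewrite /df /GRing.scale /=.
  (* As w x ^+ 3 is the inverse of cosh x, everything becomes rational in w x. *)
  rewrite powRD; last by rewrite lt0r_neq0 ?implybT.
  rewrite powR_inv1 ?ltW// -/(w x) -w3.
  rewrite (_ : sinh x * _ = - (1 / 3) * w x ^+ 4 * sinh x ^+ 2); last by ring.
  rewrite sqr_sinh (_ : cosh x = (w x ^+ 3)^-1); last by rewrite w3 invrK.
  by have := w0 x; move: (w x) => u u0; field; lra.
have := le_of_derive_ge0 t0 Df df_ge0.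
rewrite /f sinh0 mul0r subr0 subr_ge0 /w powRN.
by rewrite ler_pdivlMr// powR_gt0// cosh_gt0.
Qed.

(** The value 1 at 0 is the continuous extension; with it the two bounds below,
    and the formula for the logarithmic mean, hold without exception at 0. *)
Definition sinhc t : R := if t == 0 then 1 else sinh t / t.

Lemma sinhcN t : sinhc (- t) = sinhc t.
Proof. by rewrite /sinhc oppr_eq0 sinhN invrN mulrNN. Qed.

Lemma cbrt_cosh_le_sinhc t : cosh t `^ (1 / 3) <= sinhc t.
Proof.
wlog : t / 0 <= t.
  move=> H; have [/H//|t0] := leP 0 t.
  by rewrite -coshN -sinhcN H// oppr_ge0 ltW.
rewrite /sinhc le_eqVlt => /predU1P[<-|t0].
  by rewrite eqxx cosh0 powR1.
by rewrite gt_eqF// ler_pdivlMr// mulrC cbrt_cosh_le// ltW.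
Qed.

Lemma sinhc_le_cosh t : sinhc t <= (2 + cosh t) / 3.
Proof.
wlog : t / 0 <= t.
  move=> H; have [/H//|t0] := leP 0 t.
  by rewrite -coshN -sinhcN H// oppr_ge0 ltW.
rewrite /sinhc le_eqVlt => /predU1P[<-|t0].
  by rewrite eqxx cosh0; lra.
rewrite gt_eqF// ler_pdivrMr// mulrAC ler_pdivlMr//.
by rewrite mulrC [leRHS]mulrC mul3_sinh_le// ltW.
Qed.

End Hyperbolic.

(** * The logarithmic mean of two numbers *)

Section Logmean.
Variable R : realType.
Implicit Types x y : R.

Lemma cosh_lnB x y : 0 < x -> 0 < y ->
  cosh (ln x - ln y) = (x ^+ 2 + y ^+ 2) / (2 * (x * y)).
Proof.
move=> x0 y0; rewrite /cosh opprB !expRD !expRN !lnK ?posrE//.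
by field; lra.
Qed.

Lemma sinh_lnB x y : 0 < x -> 0 < y ->
  sinh (ln x - ln y) = (x ^+ 2 - y ^+ 2) / (2 * (x * y)).
Proof.
move=> x0 y0; rewrite /sinh opprB !expRD !expRN !lnK ?posrE//.
by field; lra.
Qed.

(** Squares are used so that the geometric mean of the arguments is the
    polynomial x y. *)
Lemma logmean_sqr x y : 0 < x -> 0 < y ->
  logmean (x ^+ 2) (y ^+ 2) = x * y * sinhc (ln x - ln y).
Proof.
move=> x0 y0; rewrite /logmean /sinhc eqrXn2 ?ltW// subr_eq0.
rewrite (inj_in_eq (@ln_inj R)) ?posrE//.
have [->|xy] := eqVneq x y; first by rewrite mulr1 expr2.
have : ln x - ln y != 0.
  by rewrite subr_eq0 (inj_in_eq (@ln_inj R)) ?posrE.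
rewrite sinh_lnB// !lnXn//; move: (ln x) (ln y) => u v uv.
rewrite -mulrnBl -mulr_natr.
by field; rewrite uv; lra.
Qed.

Lemma cbrtX3 x : 0 <= x -> (x ^+ 3) `^ (1 / 3) = x.
Proof.
move=> x0; rewrite -powR_mulrn// -powRrM (_ : 3 * (1 / 3) = 1) ?powRr1//.
by field.
Qed.

(** The Leach-Sholander inequality (G^2 A)^(1/3) <= L. *)
Lemma logmean_sqr_ge x y : 0 < x -> 0 < y ->
  (x ^+ 2 * (x ^+ 2 + y ^+ 2) * y ^+ 2 / 2) `^ (1 / 3)
    <= logmean (x ^+ 2) (y ^+ 2).
Proof.
move=> x0 y0; have xy0 : 0 < x * y by rewrite mulr_gt0.
rewrite logmean_sqr//.
rewrite (_ : _ / 2 = (x * y) ^+ 3 * cosh (ln x - ln y)); last first.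
  by rewrite cosh_lnB//; field; lra.
rewrite powRM ?exprn_ge0 ?(ltW xy0) ?(ltW (cosh_gt0 _))//.
by rewrite cbrtX3 ?(ltW xy0)// ler_pM2l// cbrt_cosh_le_sinhc.
Qed.

Lemma mul_le_mean_sqr x y : x * y <= (x ^+ 2 + y ^+ 2) / 2.
Proof. by have := sqr_ge0 (x - y); rewrite sqrrB; lra. Qed.

(** Since G^3 = G^2 G <= G^2 A. *)
Lemma geom_mean_le_cbrt x y : 0 < x -> 0 < y ->
  x * y <= (x ^+ 2 * (x ^+ 2 + y ^+ 2) * y ^+ 2 / 2) `^ (1 / 3).
Proof.
move=> x0 y0; have xy0 : 0 <= x * y by rewrite mulr_ge0// ltW.
rewrite -[leLHS]cbrtX3//.
have E : (x * y) ^+ 3 <= x ^+ 2 * (x ^+ 2 + y ^+ 2) * y ^+ 2 / 2.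
  rewrite [leRHS](_ : _ = (x * y) ^+ 2 * ((x ^+ 2 + y ^+ 2) / 2)).
    by rewrite exprSr ler_wpM2l ?sqr_ge0// mul_le_mean_sqr.
  by field.
by apply: ge0_ler_powR; rewrite ?nnegrE ?exprn_ge0// (le_trans _ E)// exprn_ge0.
Qed.

(** Carlson's inequality L <= (2 G + A)/3. *)
Lemma logmean_sqr_le x y : 0 < x -> 0 < y ->
  logmean (x ^+ 2) (y ^+ 2) <= (2 * (x * y) + (x ^+ 2 + y ^+ 2) / 2) / 3.
Proof.
move=> x0 y0; have xy0 : 0 < x * y by rewrite mulr_gt0.
rewrite logmean_sqr// [leRHS](_ : _ = x * y * ((2 + cosh (ln x - ln y)) / 3)).
  by rewrite ler_pM2l// sinhc_le_cosh.
by rewrite cosh_lnB//; field; lra.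
Qed.

(** * Subdivision into equal ratios *)

(** For x <> y, the factor is the quotient of x^(m+1) - y^(m+1) by
    (m+1) (x - y), where m+1 comes from the logarithms in the denominator. *)
Lemma logmeanX m x y : 0 < x -> 0 < y ->
  logmean (x ^+ m.+1) (y ^+ m.+1)
  = (\sum_(i < m.+1) x ^+ (m - i) * y ^+ i) / m.+1%:R * logmean x y.
Proof.
move=> x0 y0; have m0 : m.+1%:R != 0 :> R by rewrite pnatr_eq0.
rewrite /logmean eqrXn2 ?ltW//; have [<-|xy] := eqVneq x y.
  rewrite (eq_bigr (fun=> x ^+ m)) => [|i _]; last first.
    by rewrite -exprD subnK// -ltnS.
  rewrite sumr_const card_ord -mulr_natr exprSr.
  by field.
have : ln x - ln y != 0.
  by rewrite subr_eq0 (inj_in_eq (@ln_inj R)) ?posrE.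
rewrite subrXX !lnXn// -mulrnBl -[_ *+ m.+1]mulr_natr => uv.
move: (\sum_(_ < _) _) => S; move: (m.+1%:R) m0 uv => k k0 uv.
rewrite /=; field.
by rewrite uv k0.
Qed.

(** Splitting off the last term of the left sum leaves y times the right sum,
    splitting off the first leaves x times it; average the two identities. *)
Lemma trapezoid_sum n x y :
  \sum_(i < n.+2) x ^+ i * y ^+ (n.+1 - i) - (x ^+ n.+1 + y ^+ n.+1) / 2
  = (x + y) / 2 * \sum_(i < n.+1) x ^+ (n - i) * y ^+ i.
Proof.
rewrite [in RHS](reindex_inj rev_ord_inj) /=.
rewrite [in RHS](eq_bigr (fun i : 'I_n.+1 => x ^+ i * y ^+ (n - i))); last first.
  by move=> i _; rewrite subSS subKn// -ltnS.
set S := (\sum_(i < n.+1) _).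
have Ex : \sum_(i < n.+2) x ^+ i * y ^+ (n.+1 - i) = y * S + x ^+ n.+1.
  rewrite big_ord_recr /= subnn mulr1 big_distrr /=; congr (_ + _).
  by apply: eq_bigr => i _; rewrite mulrCA -exprS subSn// -ltnS.
have Ey : \sum_(i < n.+2) x ^+ i * y ^+ (n.+1 - i) = y ^+ n.+1 + x * S.
  rewrite big_ord_recl /= subn0 mul1r big_distrr /=; congr (_ + _).
  by apply: eq_bigr => i _; rewrite mulrA -exprS.
lra.
Qed.

Lemma powR_natdiv (a d e : R) n : 0 < a ->
  d = n%:R / e -> a `^ d = (a `^ (1 / e)) ^+ n.
Proof.
move=> a0 ->.
by rewrite -powR_mulrn ?powR_ge0// -powRrM mulrC mul1r [_ * n%:R]mulrC.
Qed.

End Logmean.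

Theorem theorem2p5 (R : realType) (a b : R) (m : nat)
  (a_gt0 : 0 < a) (b_gt0 : 0 < b) (m_ge1 : (1 <= m)%N) :
  (1 / m%:R *
     (\sum_(1 <= k < m.+1)
        a `^ ((2 * k%:R - 1) / (2 * m%:R)) *
        b `^ ((2 * m%:R - (2 * k%:R - 1)) / (2 * m%:R)))
   <= (1 / m%:R *
        (\sum_(1 <= k < m.+1)
           a `^ ((m%:R - k%:R) / m%:R) * b `^ ((k%:R - 1) / m%:R))) *
      (a `^ (1 / m%:R) * (a `^ (1 / m%:R) + b `^ (1 / m%:R)) *
         b `^ (1 / m%:R) / 2) `^ (1 / 3)
   <= logmean a b)
  /\
  (logmean a b
   <= 2 / (3 * m%:R) *
        (\sum_(1 <= k < m.+1)
           a `^ ((2 * k%:R - 1) / (2 * m%:R)) *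
           b `^ ((2 * m%:R - (2 * k%:R - 1)) / (2 * m%:R)))
      + 1 / (3 * m%:R) *
        ((\sum_(0 <= k < m.+1)
            a `^ (k%:R / m%:R) * b `^ ((m%:R - k%:R) / m%:R))
         - (a + b) / 2)
   <= 1 / m%:R *
        ((\sum_(0 <= k < m.+1)
            a `^ (k%:R / m%:R) * b `^ ((m%:R - k%:R) / m%:R))
         - (a + b) / 2)).
Proof.
case: m m_ge1 => // n _; set m := n.+1.
have m0 : m%:R != 0 :> R by rewrite pnatr_eq0.
have m_gt0 : 0 < m%:R :> R by rewrite ltr0n.
set x := a `^ (1 / (2 * m%:R)); set y := b `^ (1 / (2 * m%:R)).
have x0 : 0 < x by exact: powR_gt0.
have y0 : 0 < y by exact: powR_gt0.
pose S := \sum_(i < m) (x ^+ 2) ^+ (n - i) * (y ^+ 2) ^+ i.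
have S_ge0 : 0 <= S.
  by apply: sumr_ge0 => i _; rewrite mulr_ge0 ?exprn_ge0 ?ltW.
have rootE : (a `^ (1 / m%:R) = x ^+ 2) * (b `^ (1 / m%:R) = y ^+ 2).
  by split; apply: powR_natdiv => //; field.
have aE : a = (x ^+ 2) ^+ m.
  rewrite -rootE -[LHS]powRr1 ?(ltW a_gt0)//.
  by apply: powR_natdiv => //; field.
have bE : b = (y ^+ 2) ^+ m.
  rewrite -rootE -[LHS]powRr1 ?(ltW b_gt0)//.
  by apply: powR_natdiv => //; field.
have midE : \sum_(1 <= k < m.+1)
    a `^ ((2 * k%:R - 1) / (2 * m%:R)) *
    b `^ ((2 * m%:R - (2 * k%:R - 1)) / (2 * m%:R)) = x * y * S.
  rewrite big_add1 /= big_mkord /S (reindex_inj rev_ord_inj) big_distrr /=.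
  apply: eq_bigr => i _; have im : (i <= n)%N by rewrite -ltnS.
  rewrite (@powR_natdiv R a _ (2 * m%:R) (n - i).*2.+1)//; last first.
    by rewrite subSS -natr1 -muln2 -[in RHS]natr1 natrM; field.
  rewrite (@powR_natdiv R b _ (2 * m%:R) i.*2.+1)//; last first.
    rewrite subSS /m -!natr1 natrB// -muln2 natrM; field.
    by rewrite natr1.
  rewrite -/x -/y -!muln2 ![(_ * 2)%N]mulnC -!exprM !exprS; ring.
have leftE : \sum_(1 <= k < m.+1)
    a `^ ((m%:R - k%:R) / m%:R) * b `^ ((k%:R - 1) / m%:R) = S.
  rewrite big_add1 /= big_mkord; apply: eq_bigr => i _.
  have im : (i <= n)%N by rewrite -ltnS.
  rewrite -!rootE (@powR_natdiv R a _ m%:R (n - i))//; last first.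
    by rewrite natrB// /m -!natr1; congr (_ / _); ring.
  by rewrite (@powR_natdiv R b _ m%:R i)// -natr1; congr (_ / _); ring.
have trapE : \sum_(0 <= k < m.+1)
    a `^ (k%:R / m%:R) * b `^ ((m%:R - k%:R) / m%:R) - (a + b) / 2
    = (x ^+ 2 + y ^+ 2) / 2 * S.
  rewrite -trapezoid_sum -aE -bE; congr (_ - _).
  rewrite big_mkord; apply: eq_bigr => i _.
  have im : (i <= m)%N by rewrite -ltnS.
  rewrite -!rootE (@powR_natdiv R a _ m%:R i)//.
  by rewrite (@powR_natdiv R b _ m%:R (m - i))// natrB.
rewrite midE leftE trapE !rootE.
have -> : logmean a b = S / m%:R * logmean (x ^+ 2) (y ^+ 2).
  (* The arguments are given because x ^+ 2 itself also has the shape of a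
     power to which the lemma applies. *)
  by rewrite aE bE (@logmeanX R n (x ^+ 2) (y ^+ 2)) ?exprn_gt0.
have Sm_ge0 : 0 <= S / m%:R by rewrite divr_ge0// ltW.
have amgm := mul_le_mean_sqr x y.
have carlsonE : 2 / (3 * m%:R) * (x * y * S)
    + 1 / (3 * m%:R) * ((x ^+ 2 + y ^+ 2) / 2 * S)
    = S / m%:R * ((2 * (x * y) + (x ^+ 2 + y ^+ 2) / 2) / 3) by field.
split; apply/andP; split.
- rewrite mul1r [x * y * S]mulrC mulrA [_^-1 * S]mulrC ler_wpM2l//.
  exact: geom_mean_le_cbrt.
- by rewrite mul1r [_^-1 * S]mulrC ler_wpM2l// logmean_sqr_ge.
- by rewrite carlsonE ler_wpM2l// logmean_sqr_le.
- rewrite carlsonE [leRHS](_ : _ = S / m%:R * ((x ^+ 2 + y ^+ 2) / 2)).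
    by rewrite ler_wpM2l//; lra.
  by field.
Qed.
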